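(* Let $g:\mathbb{R}^n\to\mathbb{R}\cup\{+\infty\}$ be proper, lower semicontinuous and convex; let $f:\mathbb{R}^n\to\mathbb{R}$ be twice differentiable and $\mu$-strongly convex, with $L$-Lipschitz gradient and $L_H$-Lipschitz Hessian ($\mu,L,L_H>0$); and suppose that $F:=g+f$ is bounded from below. Let $\bar\kappa\ge L$. For any initialization $x_0\in\mathbb{R}^n$ and any $N\in\mathbb{N}$, the algorithm Grad SR1 PQN with parameter $\bar\kappa$ (defined in the context) has a global convergence with the rate $$\|F'(x_N)\|\le\left(\frac{C_{\mathrm{grad}}}{N^{1/4}}\right)^{N/2}\|F'(x_0)\|,$$ where $C_{\mathrm{grad}}:=(n\bar\kappa\Theta+nL)/\mu$, $\Theta:=\frac1\mu\left(L_HC_0+\sqrt{L_H(L+n\bar\kappa)C_0}\right)$ and $C_0:=\sqrt{\frac{2(F(x_0)-\inf F)}{\mu}}$.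
   Context: Conventions. $\|\cdot\|$ is the Euclidean norm on $\mathbb{R}^n$ and the induced operator norm on matrices; the Lipschitz property of $\nabla^2 f$ is with respect to these norms. $\|x\|_M^2:=x^\top Mx$; $I$ is the identity matrix; $\partial$ is the convex subdifferential; $A\preceq B$ (resp. $A\prec B$) means $B-A$ is positive semidefinite (resp. positive definite). SR1 update. For symmetric matrices $A,G$ (with $0\prec A\preceq G$) and $u\in\mathbb{R}^n$: $\mathrm{SR1}(A,G,u):=G$ if $(G-A)u=0$, and $\mathrm{SR1}(A,G,u):=G-\frac{(G-A)uu^\top(G-A)}{u^\top(G-A)u}$ otherwise. Algorithm Grad SR1 PQN. Start with $x_0$, $G_0=LI$, $\lambda_0=0$, $\tilde G_0=(1+\lambda_0)G_0=LI$ and a parameter $\bar\kappa\ge L$. For $k=0,1,2,\dots$: (1) $x_{k+1}=\operatorname{argmin}_{x\in\mathbb{R}^n}\{g(x)+\langle\nabla f(x_k),x-x_k\rangle+\frac12\|x-x_k\|^2_{\tilde G_k}\}$; (2) $u_k=x_{k+1}-x_k$, $r_k=\|u_k\|$, $J_k:=\int_0^1\nabla^2f(x_k+tu_k)\,dt$; (3) $F'(x_{k+1})=\nabla f(x_{k+1})-\nabla f(x_k)-\tilde G_ku_k$, $G_{k+1}=\mathrm{SR1}(J_k,\tilde G_k,u_k)$, $\lambda_{k+1}=\frac1\mu\left(\sqrt{L_H\|F'(x_{k+1})\|}+L_Hr_k\right)$; (4) $\hat G_{k+1}=(1+\lambda_{k+1})G_{k+1}$; if $\operatorname{trace}\hat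 G_{k+1}\le n\bar\kappa$ set $\tilde G_{k+1}=\hat G_{k+1}$, otherwise set $\tilde G_{k+1}=LI$; (5) if $\|F'(x_{k+1})\|=0$, terminate. Notation $F'$. $F'(x_k)=v_k+\nabla f(x_k)\in\partial F(x_k)$ with $v_k\in\partial g(x_k)$, where $v_{k+1}:=-\nabla f(x_k)-\tilde G_ku_k$ (this agrees with step (3)); for $k=0$ no particular choice of $v_0$ is prescribed. Standing convention. Without loss of generality $\|F'(x_k)\|>0$ for all $k\in\mathbb{N}$, since otherwise the algorithm terminates after finitely many steps and the rate holds until then. *)

(* Defs.v *)
From HB Require Import structures.
From mathcomp Require Import all_boot all_order all_algebra.
From mathcomp Require Import all_classical all_reals all_analysis.

Set Implicit Arguments.
Unset Strict Implicit.
Unset Printing Implicit Defensive.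

Import Order.TTheory GRing.Theory Num.Theory.
Import numFieldNormedType.Exports.

Local Open Scope classical_set_scope.
Local Open Scope ring_scope.

Definition dot (R : realType) (n : nat) (u v : 'cV[R]_n) : R :=
  (u^T *m v) 0 0.

(* The library norm on matrices is the sup norm, hence a separate Euclidean
   norm; both induce the same topology and the same notion of
   differentiability. *)
Definition enorm (R : realType) (n : nat) (u : 'cV[R]_n) : R :=
  Num.sqrt (dot u u).

Definition opnorm (R : realType) (n : nat) (A : 'M[R]_n) : R :=
  sup [set enorm (A *m v) | v in [set v : 'cV[R]_n | enorm v <= 1]].

Definition sqnormM (R : realType) (n : nat) (M : 'M[R]_n) (u : 'cV[R]_n) : R :=
  (u^T *m M *m u) 0 0.

Definition grad (R : realType) (n : nat) (f : 'cV[R]_n -> R) (x : 'cV[R]_n)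
    : 'cV[R]_n :=
  \col_i 'D_(delta_mx i 0) f x.

Definition hess (R : realType) (n : nat) (f : 'cV[R]_n -> R) (x : 'cV[R]_n)
    : 'M[R]_n :=
  \matrix_(i, j) ('D_(delta_mx j 0) (grad f) x) i 0.

Definition twice_differentiable (R : realType) (n : nat)
    (f : 'cV[R]_n -> R) : Prop :=
  (forall x, differentiable f x) /\ (forall x, differentiable (grad f) x).

Definition strongly_convex (R : realType) (n : nat) (mu : R)
    (f : 'cV[R]_n -> R) : Prop :=
  forall (x y : 'cV[R]_n) (t : R), 0 <= t <= 1 ->
    f (t *: x + (1 - t) *: y) <=
      t * f x + (1 - t) * f y - mu / 2 * t * (1 - t) * enorm (x - y) ^+ 2.

Definition lipschitz_grad (R : realType) (n : nat) (L : R)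
    (f : 'cV[R]_n -> R) : Prop :=
  forall x y : 'cV[R]_n, enorm (grad f x - grad f y) <= L * enorm (x - y).

Definition lipschitz_hess (R : realType) (n : nat) (LH : R)
    (f : 'cV[R]_n -> R) : Prop :=
  forall x y : 'cV[R]_n, opnorm (hess f x - hess f y) <= LH * enorm (x - y).

Definition proper_efun (T : Type) (R : realType) (g : T -> \bar R) : Prop :=
  (forall x, g x != -oo%E) /\ (exists x, g x != +oo%E).

Definition convex_efun (R : realType) (n : nat) (g : 'cV[R]_n -> \bar R)
    : Prop :=
  forall (x y : 'cV[R]_n) (t : R), 0 <= t <= 1 ->
    (g (t *: x + (1 - t) *: y)%R <= t%:E * g x + (1 - t)%:E * g y)%E.

(* For a proper g this set is empty outside the domain of g. *)
Definition subdiff (R : realType) (n : nat) (g : 'cV[R]_n -> \bar R)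
    (x : 'cV[R]_n) : set 'cV[R]_n :=
  [set v | forall y, (g x + (dot v (y - x))%:E <= g y)%E].

Definition objective (R : realType) (n : nat) (g : 'cV[R]_n -> \bar R)
    (f : 'cV[R]_n -> R) (x : 'cV[R]_n) : \bar R :=
  (g x + (f x)%:E)%E.

Definition is_argmin (T : Type) (R : realType) (h : T -> \bar R) (x : T)
    : Prop :=
  forall y, (h x <= h y)%E.

Definition SR1 (R : realType) (n : nat) (A G : 'M[R]_n) (u : 'cV[R]_n)
    : 'M[R]_n :=
  if (G - A) *m u == 0 then G
  else G - (sqnormM (G - A) u)^-1 *: ((G - A) *m u *m u^T *m (G - A)).

Definition mean_hess (R : realType) (n : nat) (f : 'cV[R]_n -> R)
    (x u : 'cV[R]_n) : 'M[R]_n :=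
  \matrix_(i, j) \int[lebesgue_measure]_(t in `[0%R, 1%R])
    (hess f (x + t *: u) i j).

Definition prox_model (R : realType) (n : nat) (g : 'cV[R]_n -> \bar R)
    (f : 'cV[R]_n -> R) (M : 'M[R]_n) (xk x : 'cV[R]_n) : \bar R :=
  (g x + (dot (grad f xk) (x - xk) + 2^-1 * sqnormM M (x - xk))%:E)%E.

(* Iterations k = 0, ..., N - 1 have all been carried out: by [run_continue], no
   termination test before that of iteration N - 1 succeeded.  [F' k] is the
   subgradient F'(x_k), where v0 is meant to be a subgradient of g at x0, and
   [Gt k] is \tilde G_k. *)
Record GradSR1PQN (R : realType) (n : nat) (g : 'cV[R]_n -> \bar R)
    (f : 'cV[R]_n -> R) (mu L LH kbar : R) (N : nat) (x0 v0 : 'cV[R]_n)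
    (x F' : nat -> 'cV[R]_n) (G Gt : nat -> 'M[R]_n) (lam : nat -> R)
    : Prop := {
  run_x0 : x 0%N = x0 ;
  run_F0 : F' 0%N = v0 + grad f x0 ;
  run_G0 : G 0%N = L%:M ;
  run_lam0 : lam 0%N = 0 ;
  run_Gt0 : Gt 0%N = (1 + lam 0%N) *: G 0%N ;
  run_x : forall k, (k < N)%N ->
    is_argmin (prox_model g f (Gt k) (x k)) (x k.+1) ;
  run_F : forall k, (k < N)%N ->
    F' k.+1 = grad f (x k.+1) - grad f (x k) - Gt k *m (x k.+1 - x k) ;
  run_G : forall k, (k < N)%N ->
    let u := x k.+1 - x k in
    G k.+1 = SR1 (mean_hess f (x k) u) (Gt k) u ;
  run_lam : forall k, (k < N)%N ->
    let r := enorm (x k.+1 - x k) in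
    lam k.+1 = mu^-1 * (Num.sqrt (LH * enorm (F' k.+1)) + LH * r) ;
  run_Gt : forall k, (k < N)%N ->
    let Gh := (1 + lam k.+1) *: G k.+1 in
    Gt k.+1 = if \tr Gh <= n%:R * kbar then Gh else L%:M ;
  run_continue : forall k, (k.+1 < N)%N -> enorm (F' k.+1) != 0
}.

(* Main.v *)
Require Import Defs.
From HB Require Import structures.
From mathcomp Require Import all_boot all_order all_algebra.
From mathcomp Require Import all_classical all_reals all_analysis.
From mathcomp Require Import ring lra.
Import Order.TTheory GRing.Theory Num.Theory.
Import numFieldNormedType.Exports.
Local Open Scope classical_set_scope.
Local Open Scope ring_scope.

Set Implicit Arguments.
Unset Strict Implicit.
Unset Printing Implicit Defensive.

(** Write [u_k = x_{k+1} - x_k], [r_k = |u_k|], [J_k] for the mean Hessian along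
    [u_k] and [P_k = Gt_k - J_k].  The fundamental theorem of calculus gives
    [F'_{k+1} = - P_k u_k].  Monotonicity of the subdifferential of [g] gives
    [u_k^T Gt_k u_k <= |F'_k| r_k], and the regularisation [lam_{k+1}] is large
    enough to make [J_{k+1} <= Gt_{k+1}], so all [P_k] are positive semidefinite
    and [mu r_k <= |F'_k|].

    One SR1 step lowers the trace by exactly
    [d_k = |P_k u_k|^2 / (u_k^T P_k u_k)], whence
    [|F'_{k+1}|^2 <= (d_k / mu) |F'_k|^2].  Strong convexity of [F] gives
    [F(x_k) - F(x_{k+1}) >= (mu / 2) r_k^2], so [r] is square summable; together
    with [|F'_{k+1}| <= n kbar r_k] this bounds the sum of [lam_{k+1}] by
    [Theta N^{3/4}], and telescoping traces bounds the sum of [d_k / mu] by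
    [Cgrad N^{3/4}].  The rate is then the inequality between arithmetic and
    geometric means applied to the factors [d_k / mu]. *)

(** * Euclidean geometry and the SR1 update *)

Section Euclidean.
Variables (R : realType) (n : nat).
Implicit Types (u v w : 'cV[R]_n) (A B P : 'M[R]_n) (a c : R).

Lemma dotE u v : dot u v = \sum_i u i 0 * v i 0.
Proof. by rewrite /dot mxE; apply: eq_bigr => i _; rewrite mxE. Qed.

Lemma dotC u v : dot u v = dot v u.
Proof. by rewrite !dotE; apply: eq_bigr => i _; rewrite mulrC. Qed.

Lemma dotDr u v w : dot u (v + w) = dot u v + dot u w.
Proof. by rewrite /dot mulmxDr mxE. Qed.

Lemma dotZr a u v : dot u (a *: v) = a * dot u v.
Proof. by rewrite /dot -scalemxAr mxE. Qed.

Lemma dotNr u v : dot u (- v) = - dot u v.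
Proof. by rewrite -scaleN1r dotZr mulN1r. Qed.

Lemma dotBr u v w : dot u (v - w) = dot u v - dot u w.
Proof. by rewrite dotDr dotNr. Qed.

Lemma dotDl u v w : dot (u + v) w = dot u w + dot v w.
Proof. by rewrite dotC dotDr !(dotC w). Qed.

Lemma dotZl a u v : dot (a *: u) v = a * dot u v.
Proof. by rewrite dotC dotZr dotC. Qed.

Lemma dotNl u v : dot (- u) v = - dot u v.
Proof. by rewrite dotC dotNr dotC. Qed.

Lemma dotBl u v w : dot (u - v) w = dot u w - dot v w.
Proof. by rewrite dotDl dotNl. Qed.

Lemma dot0r u : dot u 0 = 0.
Proof. by rewrite /dot mulmx0 mxE. Qed.

Lemma dot_mulmxr u A v : dot u (A *m v) = dot (A^T *m u) v.
Proof. by rewrite /dot trmx_mul trmxK mulmxA. Qed.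

Lemma dot_ge0 u : 0 <= dot u u.
Proof. by rewrite dotE sumr_ge0 // => i _; rewrite -expr2 sqr_ge0. Qed.

Lemma enorm_ge0 u : 0 <= enorm u.
Proof. exact: sqrtr_ge0. Qed.

Lemma enormK u : enorm u ^+ 2 = dot u u.
Proof. by rewrite /enorm sqr_sqrtr ?dot_ge0. Qed.

Lemma enorm0_eq0 u : enorm u = 0 -> u = 0.
Proof.
move=> u0; have : dot u u = 0 by rewrite -enormK u0 expr0n.
rewrite dotE => /eqP; rewrite psumr_eq0 => [/allP h|i _]; last first.
  by rewrite -expr2 sqr_ge0.
apply/colP => i; rewrite mxE.
by have := h i (mem_index_enum _); rewrite /= mulf_eq0 orbb => /eqP.
Qed.

Lemma enormZ a u : enorm (a *: u) = `|a| * enorm u.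
Proof.
by rewrite /enorm dotZl dotZr mulrA -expr2 sqrtrM ?sqr_ge0 // sqrtr_sqr.
Qed.

Lemma enormN u : enorm (- u) = enorm u.
Proof. by rewrite -scaleN1r enormZ normrN normr1 mul1r. Qed.

(** The form is homogeneous in [s] and [t] so that [c = 0] is covered; for [c > 0] the choice
    [s = c], [t = - b] leaves [c * (a * c - b ^+ 2)]. *)
Lemma discriminant_le0 a b c :
  (forall s t, 0 <= s ^+ 2 * a + 2 * s * t * b + t ^+ 2 * c) -> b ^+ 2 <= a * c.
Proof.
move=> h; have a0 : 0 <= a by have := h 1 0; lra.
have : 0 <= c by have := h 0 1; lra.
rewrite le_eqVlt => /orP[/eqP c0|c0].
  case: (eqVneq b 0) => [->|b0]; first by rewrite -c0; lra.
  (* With [c = 0] the form at [s = 1] is affine in [t], and this [t] makes it equal to [- 1]. *)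
  have := h 1 (- (a + 1) / (2 * b)); rewrite -c0.
  have -> : 1 ^+ 2 * a + 2 * 1 * (- (a + 1) / (2 * b)) * b +
    (- (a + 1) / (2 * b)) ^+ 2 * 0 = - 1 by field.
  by lra.
rewrite -subr_ge0 -(pmulr_rge0 _ c0).
by have := h c (- b); congr (0 <= _); ring.
Qed.

Lemma psd_cauchy_schwarz P u v : P^T = P -> (forall w, 0 <= sqnormM P w) ->
  dot u (P *m v) ^+ 2 <= dot u (P *m u) * dot v (P *m v).
Proof.
move=> Psym Ppos; apply: discriminant_le0 => s t.
have := Ppos (s *: u + t *: v).
rewrite /sqnormM -mulmxA -/(dot _ _) mulmxDr -!scalemxAr.
rewrite !(dotDl, dotDr, dotZl, dotZr).
have -> : dot v (P *m u) = dot u (P *m v) by rewrite dotC [RHS]dot_mulmxr Psym.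
by congr (0 <= _); ring.
Qed.

Lemma sqnormME A u : sqnormM A u = dot u (A *m u).
Proof. by rewrite /sqnormM -mulmxA. Qed.

Lemma sqnormM_scalar a u : sqnormM a%:M u = a * enorm u ^+ 2.
Proof. by rewrite sqnormME mul_scalar_mx dotZr enormK. Qed.

Lemma sqnormMB A B u : sqnormM (A - B) u = sqnormM A u - sqnormM B u.
Proof. by rewrite !sqnormME mulmxBl dotBr. Qed.

Lemma sqnormMZ a A u : sqnormM (a *: A) u = a * sqnormM A u.
Proof. by rewrite !sqnormME -scalemxAl dotZr. Qed.

Lemma dot_le_enorm u v : dot u v <= enorm u * enorm v.
Proof.
have := @psd_cauchy_schwarz 1%:M u v (trmx1 _ _).
rewrite !mul1mx => h; apply: (le_trans (ler_norm _)).
rewrite -(@ler_pXn2r _ 2) ?nnegrE ?normr_ge0 ?mulr_ge0 ?enorm_ge0 //.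
rewrite real_normK ?num_real // exprMn !enormK; apply: h => w.
by rewrite sqnormME mul1mx dot_ge0.
Qed.

Lemma enormD u v : enorm (u + v) <= enorm u + enorm v.
Proof.
rewrite -(@ler_pXn2r _ 2) ?nnegrE ?addr_ge0 ?enorm_ge0 //.
rewrite enormK dotDl !dotDr (dotC v u) sqrrD !enormK.
by have := dot_le_enorm u v; lra.
Qed.

Lemma coord_le_enorm u i : `|u i 0| <= enorm u.
Proof.
rewrite -sqrtr_sqr ler_wsqrtr // dotE (bigD1 i) //= -expr2 lerDl.
by rewrite sumr_ge0 // => j _; rewrite -expr2 sqr_ge0.
Qed.

Lemma sqnormM_delta A i : sqnormM A (delta_mx i 0) = A i i.
Proof.
by rewrite sqnormME -colE dotC dotE (bigD1 i) //= !mxE !eqxx mulr1 big1 ?addr0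
  // => j ji; rewrite !mxE (negbTE ji) mulr0.
Qed.

Lemma psd_tr_ge0 P : (forall w, 0 <= sqnormM P w) -> 0 <= \tr P.
Proof. by move=> h; rewrite sumr_ge0 // => i _; rewrite -sqnormM_delta. Qed.

(** The Frobenius norm bounds the set in [opnorm] from above, so that its [sup] really is an upper
    bound. *)
Lemma enorm_mulmx_le A u :
  enorm (A *m u) <= Num.sqrt (\sum_i enorm (row i A)^T ^+ 2) * enorm u.
Proof.
have s0 : 0 <= \sum_i enorm (row i A)^T ^+ 2.
  by rewrite sumr_ge0 // => i _; rewrite sqr_ge0.
rewrite -(@ler_pXn2r _ 2) ?nnegrE ?mulr_ge0 ?sqrtr_ge0 ?enorm_ge0 //.
rewrite exprMn (sqr_sqrtr s0) enormK dotE mulr_suml ler_sum // => i _.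
have -> : (A *m u) i 0 = dot (row i A)^T u.
  by rewrite mxE dotE; apply: eq_bigr => j _; rewrite !mxE.
rewrite -expr2 -exprMn -(real_normK (num_real (dot _ _))).
rewrite ler_pXn2r ?nnegrE ?mulr_ge0 ?enorm_ge0 // ler_norml dot_le_enorm.
by rewrite andbT lerNl -dotNl (le_trans (dot_le_enorm _ _)) // enormN.
Qed.

Lemma enorm_mulmx_opnorm A u : enorm (A *m u) <= opnorm A * enorm u.
Proof.
have [u0|u0] := eqVneq (enorm u) 0.
  by rewrite (enorm0_eq0 u0) mulmx0 /enorm !dot0r sqrtr0 mulr0.
have u_gt0 : 0 < enorm u by rewrite lt_neqAle eq_sym u0 enorm_ge0.
rewrite -ler_pdivrMr //; apply: sup_ubound.
  exists (Num.sqrt (\sum_i enorm (row i A)^T ^+ 2)) => _ [v /= v1 <-].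
  rewrite (le_trans (enorm_mulmx_le _ _)) // ler_piMr // sqrtr_ge0.
exists ((enorm u)^-1 *: u) => /=.
  by rewrite enormZ ger0_norm ?invr_ge0 ?enorm_ge0 // mulVf.
by rewrite -scalemxAr enormZ ger0_norm ?invr_ge0 ?enorm_ge0 // mulrC.
Qed.

Lemma entryB_le_opnorm A B i j : `|A i j - B i j| <= opnorm (A - B).
Proof.
have -> : A i j - B i j = (A - B) i j by rewrite !mxE.
move: (A - B) => {}A.
have -> : A i j = (A *m delta_mx j (0 : 'I_1)) i 0 by rewrite -colE mxE.
apply: (le_trans (coord_le_enorm _ _)).
apply: (le_trans (enorm_mulmx_opnorm _ _)).
suff -> : enorm (delta_mx j (0 : 'I_1) : 'cV[R]_n) = 1 by rewrite mulr1.
rewrite /enorm dotE (bigD1 j) //= !mxE !eqxx mulr1 big1 ?addr0 ?sqrtr1 //.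
by move=> k kj; rewrite !mxE (negbTE kj) mulr0.
Qed.

Lemma dot_mulmx_le_opnorm A u v :
  dot u (A *m v) <= opnorm A * enorm u * enorm v.
Proof.
apply: (le_trans (dot_le_enorm _ _)).
rewrite -mulrA (mulrCA (opnorm A)) ler_wpM2l ?enorm_ge0 //.
exact: enorm_mulmx_opnorm.
Qed.

End Euclidean.

Section SR1_update.
Variables (R : realType) (n : nat).
Variables (A G : 'M[R]_n) (u : 'cV[R]_n).
Hypotheses (A_sym : A^T = A) (G_sym : G^T = G).
Hypothesis A_le_G : forall w, sqnormM A w <= sqnormM G w.

Let P := G - A.

Let P_sym : P^T = P. Proof. by rewrite linearB /= A_sym G_sym. Qed.

Let P_psd w : 0 <= sqnormM P w.
Proof. by rewrite sqnormMB subr_ge0. Qed.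

Lemma SR1_sym : (SR1 A G u)^T = SR1 A G u.
Proof.
rewrite /SR1 -/P; case: ifP => // _.
rewrite linearB linearZ /= G_sym; congr (_ - _ *: _).
by rewrite !trmx_mul trmxK P_sym !mulmxA.
Qed.

(** Cauchy-Schwarz for [P] at [P u] and [u] bounds [|P u|^4] by a multiple of [u^T P u]. Hence the
    SR1 denominator vanishes only if [P u] does. *)
Let Pu_psd_gt0 : P *m u != 0 -> 0 < sqnormM P u.
Proof.
move=> Pu0; rewrite lt_neqAle P_psd andbT eq_sym.
apply/eqP => uPu0; move/eqP: Pu0; apply.
have := @psd_cauchy_schwarz R n P (P *m u) u P_sym P_psd.
rewrite -(sqnormME P u) uPu0 mulr0 => h.
apply: enorm0_eq0; apply/eqP; rewrite -sqrf_eq0 enormK.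
by rewrite -sqrf_eq0 eq_le h sqr_ge0.
Qed.

Lemma sqnormM_SR1 w : P *m u != 0 ->
  sqnormM (SR1 A G u) w = sqnormM G w - (sqnormM P u)^-1 * dot w (P *m u) ^+ 2.
Proof.
move=> Pu0; rewrite /SR1 -/P (negbTE Pu0) sqnormMB sqnormMZ; congr (_ - _ * _).
rewrite sqnormME -(mulmxA _ P w) -mulmxA (mx11_scalar (u^T *m _)) -/(dot _ _).
by rewrite mul_mx_scalar dotZr dot_mulmxr P_sym dotC expr2.
Qed.

(** By Cauchy-Schwarz for [P], the subtracted form [(w^T P u)^2 / (u^T P u)] is at most
    [w^T P w]. *)
Lemma SR1_ge w : sqnormM A w <= sqnormM (SR1 A G u) w.
Proof.
have [Pu0|Pu0] := eqVneq (P *m u) 0; first by rewrite /SR1 -/P Pu0 eqxx.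
rewrite sqnormM_SR1 // lerBrDr -lerBrDl -sqnormMB.
rewrite mulrC ler_pdivrMr ?Pu_psd_gt0 //.
by rewrite (le_trans (psd_cauchy_schwarz _ _ _ _)) // -?sqnormME.
Qed.

Lemma SR1_le w : sqnormM (SR1 A G u) w <= sqnormM G w.
Proof.
have [Pu0|Pu0] := eqVneq (P *m u) 0; first by rewrite /SR1 -/P Pu0 eqxx.
by rewrite sqnormM_SR1 // gerBl mulr_ge0 ?sqr_ge0 // invr_ge0 P_psd.
Qed.

(** The removed rank-one matrix is a multiple of [(P u) (P u)^T], whose trace is [|P u|^2]. With the
    denominator kept as a factor, the identity includes the case [P u = 0]. *)
Lemma SR1_tr_decrease :
  enorm (P *m u) ^+ 2 = (\tr G - \tr (SR1 A G u)) * sqnormM P u.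
Proof.
have [Pu0|Pu0] := eqVneq (P *m u) 0.
  by rewrite /SR1 -/P Pu0 eqxx subrr mul0r enormK dot0r.
rewrite /SR1 -/P (negbTE Pu0) linearB linearZ /= opprB addrC subrK.
have -> : \tr (P *m u *m u^T *m P) = enorm (P *m u) ^+ 2.
  rewrite -mulmxA mxtrace_mulC enormK /dot trmx_mul P_sym.
  by rewrite !mulmxA /mxtrace big_ord1.
by rewrite mulrAC mulVf ?mul1r // gt_eqF // Pu_psd_gt0.
Qed.

End SR1_update.

(** * Derivatives and integrals along segments *)

Section OneVariable.
Variable R : realType.
Implicit Types phi h : R -> R.

Lemma is_derive_along_line (V W : normedModType R) (F : V -> W) (x v : V)
    (t : R) : derivable F (x + t *: v) v ->
  is_derive t (1 : R) (fun s : R => F (x + s *: v)) ('D_v F (x + t *: v)).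
Proof.
have e : (fun h : R => h^-1 *: (((fun s : R => F (x + s *: v)) \o shift t)
    (h *: (1 : R)) - F (x + t *: v))) =
    (fun h : R => h^-1 *: ((F \o shift (x + t *: v)) (h *: v)
      - F (x + t *: v))).
  apply/funext => h; congr (_ *: (F _ - _)).
  by rewrite /= [h *: 1]mulr1 scalerDl addrCA.
move=> dF; apply: DeriveDef; last by rewrite /derive e.
by rewrite /derivable e.
Qed.

(** The derivative is also a right limit, so increments to the right of [0] suffice. The term
    [t ^+ 2 * e] disappears in the limit after division by [t]; it makes room for second-order
    terms. *)
Lemma is_derive0_le phi (d c e : R) : is_derive (0 : R) (1 : R) phi d ->
  (forall t, 0 < t <= 1 -> phi t - phi 0 <= t * c + t ^+ 2 * e) -> d <= c.
Proof.
move=> [dphi dE] bnd; rewrite leNgt; apply/negP => cd.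
have /cvg_dnbhs_at_right dcv : (h^-1 *: ((phi \o shift 0) (h *: (1 : R))
    - phi 0) @[h --> (0 : R)^']) --> d by rewrite -dE; exact: dphi.
pose eps := (d - c) / 2; have eps0 : 0 < eps by rewrite /eps; lra.
move/cvgrPdist_lt : dcv => /(_ _ eps0) nr.
pose del := Num.min 1 (eps / (`|e| + 1)).
have e1 : 0 < `|e| + 1 by rewrite ltr_wpDl.
have del0 : 0 < del by rewrite lt_min ltr01 divr_gt0.
have [t [t0 t1 tn]] : exists t : R, [/\ 0 < t, t <= del &
    `|d - t^-1 *: ((phi \o shift 0) (t *: (1 : R)) - phi 0)| < eps].
  near ((0 : R)^'+) => t; exists t; split.
  - by near: t; exact: nbhs_right_gt.
  - by near: t; exact: nbhs_right_le.
  - by near: t; exact: nr.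
have := bnd t; rewrite t0 (le_trans t1) ?ge_min ?lexx // => /(_ isT) bt.
have te : t * e <= eps.
  apply: (@le_trans _ _ (t * (`|e| + 1))).
    by rewrite ler_wpM2l ?(ltW t0) // (le_trans (ler_norm e)) ?lerDl.
  by rewrite -ler_pdivlMr // (le_trans t1) // ge_min lexx orbT.
have : d - t^-1 * (phi t - phi 0) < eps.
  by move: tn; rewrite /= addr0 [t *: 1]mulr1 => /(le_lt_trans (ler_norm _)).
have : t^-1 * (phi t - phi 0) <= c + t * e.
  by rewrite ler_pdivrMl // mulrDr mulrA -expr2.
by rewrite /eps in te *; lra.
Unshelve. all: by end_near. Qed.

Lemma is_derive0_ge phi (d c : R) : is_derive (0 : R) (1 : R) phi d ->
  (forall t, 0 < t <= 1 -> t * c <= phi t - phi 0) -> c <= d.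
Proof.
move=> dphi bnd; rewrite -lerN2.
apply: (@is_derive0_le (- phi) _ _ 0) => t t01.
by rewrite !fctE; have := bnd t t01; lra.
Qed.

Lemma lipschitz_continuous h (K : R) :
  (forall s t, `|h s - h t| <= K * `|s - t|) -> continuous h.
Proof.
move=> hl t; apply/cvgrPdist_le => eps eps0.
have K1 : 0 < `|K| + 1 by rewrite ltr_wpDl.
near=> s; apply: (le_trans (hl _ _)).
apply: (@le_trans _ _ ((`|K| + 1) * `|t - s|)).
  by rewrite ler_wpM2r // (le_trans (ler_norm K)) ?lerDl.
rewrite mulrC -ler_pdivlMr //; near: s.
by apply: cvgr_dist_le => //; rewrite divr_gt0.
Unshelve. all: by end_near. Qed.

Lemma continuous_integrable01 h : continuous h ->
  lebesgue_measure.-integrable `[0%R, 1%R] (EFin \o h).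
Proof.
move=> hc; apply: continuous_compact_integrable; first exact: segment_compact.
exact: continuous_subspaceT.
Qed.

Lemma Rintegral01_cst (c : R) :
  \int[lebesgue_measure]_(t in `[0%R, 1%R]) c = c.
Proof.
rewrite Rintegral_cst //.
have := @lebesgue_measure_itv R `[0%R, 1%R].
by rewrite /= lte_fin ltr01 sube0 => ->; rewrite /= mulr1.
Qed.

(** One induction proves both claims: splitting the integral needs the integrability of the
    remaining sum, which follows from its continuity. *)
Lemma Rintegral01_sum n (c : 'I_n -> R) (h : 'I_n -> R -> R) :
  (forall i, continuous (h i)) ->
  continuous (fun t => \sum_i c i * h i t) /\
  \int[lebesgue_measure]_(t in `[0%R, 1%R]) (\sum_i c i * h i t) =
  \sum_i c i * \int[lebesgue_measure]_(t in `[0%R, 1%R]) h i t.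
Proof.
move=> hc; elim: (index_enum _) => [|i r [IHc IHi]].
  split.
    by under eq_fun do rewrite big_nil; exact: cst_continuous.
  under eq_Rintegral do rewrite big_nil.
  by rewrite big_nil Rintegral01_cst.
have cc : continuous (fun t => c i * h i t).
  by move=> t; apply: cvgM; [exact: cvg_cst | exact: hc].
split.
  under eq_fun do rewrite big_cons.
  by move=> t; apply: cvgD; [exact: cc | exact: IHc].
under eq_Rintegral do rewrite big_cons.
rewrite big_cons RintegralD //; [|exact: continuous_integrable01..].
by rewrite IHi RintegralZl //; exact: continuous_integrable01.
Qed.

Lemma Rintegral01_derive phi h : continuous h ->
  (forall t, is_derive t (1 : R) phi (h t)) ->
  \int[lebesgue_measure]_(t in `[0%R, 1%R]) h t = phi 1 - phi 0.
Proof.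
move=> hc dphi.
have phic : continuous phi.
  by move=> t; apply/differentiable_continuous/derivable1_diffP.
rewrite /Rintegral (@continuous_FTC2 _ h phi 0 1 ltr01) //.
- exact: continuous_subspaceT.
- split; first by move=> t _.
  + exact/cvg_at_right_filter/phic.
  + exact/cvg_at_left_filter/phic.
- by move=> t _; rewrite derive1E; apply: derive_val.
Qed.

End OneVariable.

(** * Gradient, Hessian and mean Hessian *)

Section TwiceDifferentiable.
Variables (R : realType) (n : nat) (f : 'cV[R]_n -> R).
Hypothesis f_diff2 : twice_differentiable f.
Implicit Types (x y u v w : 'cV[R]_n) (t : R).

Let col_sum v : v = \sum_i v i 0 *: delta_mx i 0.
Proof.
rewrite {1}(matrix_sum_delta v); apply: eq_bigr => i _.
by rewrite big_ord1.
Qed.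

Lemma derive_grad x v : 'D_v f x = dot (grad f x) v.
Proof.
have df := f_diff2.1 x; rewrite deriveE // {1}(col_sum v) linear_sum dotE.
by apply: eq_bigr => i _; rewrite linearZ /= -deriveE // mxE mulrC.
Qed.

Lemma derive_hess x v : 'D_v (grad f) x = hess f x *m v.
Proof.
have df := f_diff2.2 x; rewrite deriveE // {1}(col_sum v) linear_sum.
apply/colP => i; rewrite !mxE summxE.
by apply: eq_bigr => j _; rewrite linearZ /= -deriveE // !mxE mulrC.
Qed.

Lemma is_derive_grad x v t : is_derive t (1 : R) (fun s : R => f (x + s *: v))
  (dot (grad f (x + t *: v)) v).
Proof.
rewrite -derive_grad; apply: is_derive_along_line.
by apply: diff_derivable; exact: f_diff2.1.
Qed.

Lemma is_derive_hess x v w t :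
  is_derive t (1 : R) (fun s : R => dot w (grad f (x + s *: v)))
    (dot w (hess f (x + t *: v) *m v)).
Proof.
have dgf : derivable (grad f) (x + t *: v) v.
  by apply: diff_derivable; exact: f_diff2.2.
have d i : is_derive t (1 : R) (fun s : R => grad f (x + s *: v) i 0)
    ((hess f (x + t *: v) *m v) i 0).
  have /derivable_mxP/(_ i 0) dgfi := dgf.
  rewrite -derive_hess (derive_mx dgf) mxE.
  exact: (is_derive_along_line dgfi).
rewrite dotE.
have -> : (fun s : R => dot w (grad f (x + s *: v))) =
    \sum_i (w i 0 \*: (fun s : R => grad f (x + s *: v) i 0)).
  by apply/funext => s; rewrite fct_sumE dotE.
exact: is_derive_sum.
Qed.

(** The mean value theorem is used twice, along [u] and then along [v]. The left side is symmetric
    in [u] and [v], which is the source of the symmetry of the Hessian. *)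
Lemma second_difference_mvt x u v t : 0 < t ->
  exists2 y, enorm (y - x) <= t * (enorm u + enorm v) &
    f (x + t *: u + t *: v) - f (x + t *: u) - f (x + t *: v) + f x
      = t ^+ 2 * dot u (hess f y *m v).
Proof.
move=> t0.
pose psi (s : R) := f (x + t *: v + s *: u) - f (x + s *: u).
have dpsi s : is_derive s (1 : R) psi
    (dot (grad f (x + t *: v + s *: u)) u - dot (grad f (x + s *: u)) u).
  by apply: is_deriveB; exact: is_derive_grad.
have psic : continuous psi.
  by move=> s; apply/differentiable_continuous/derivable1_diffP.
have [s s0t psiE] := MVT t0 (fun s _ => dpsi s) (continuous_subspaceT psic).
pose chi (r : R) := dot u (grad f (x + s *: u + r *: v)).
have dchi r : is_derive r (1 : R) chi
    (dot u (hess f (x + s *: u + r *: v) *m v)) by exact: is_derive_hess.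
have chic : continuous chi.
  by move=> r; apply/differentiable_continuous/derivable1_diffP.
have [r r0t chiE] := MVT t0 (fun r _ => dchi r) (continuous_subspaceT chic).
move: s0t r0t; rewrite !in_itv /= => /andP[s0 st] /andP[r0 rt].
exists (x + s *: u + r *: v).
  have -> : x + s *: u + r *: v - x = s *: u + r *: v.
    by apply/colP => i; rewrite !mxE; ring.
  rewrite (le_trans (enormD _ _)) // !enormZ mulrDr.
  by rewrite !gtr0_norm // lerD // ler_wpM2r ?enorm_ge0 // ltW.
move: psiE chiE; rewrite /psi /chi !subr0 !scale0r !addr0.
rewrite (addrAC x (t *: v)) (addrAC x (t *: v)) => psiE chiE.
rewrite expr2 -mulrA (mulrC t (dot _ _)) -chiE !(dotC u) mulrC -psiE.
by ring.
Qed.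

Variables (mu L LH : R).
Hypothesis LH_gt0 : 0 < LH.
Hypothesis f_sconvex : strongly_convex mu f.
Hypothesis f_lip1 : lipschitz_grad L f.
Hypothesis f_lip2 : lipschitz_hess LH f.

Lemma dot_hess_lip x y u v :
  dot u (hess f x *m v) - dot u (hess f y *m v)
    <= LH * enorm (x - y) * enorm u * enorm v.
Proof.
rewrite -dotBr -mulmxBl (le_trans (dot_mulmx_le_opnorm _ _ _)) //.
by rewrite !ler_wpM2r ?enorm_ge0.
Qed.

Let split_diff (a b c d p q : R) : b = c -> a - b <= p -> c - d <= q ->
  a - d <= p + q.
Proof. lra. Qed.

Let half_frac_lt (e K : R) : 0 < e -> 0 <= K -> e / (K + 1) / 2 * K < e.
Proof.
move=> e0 K0; have K1 : 0 < K + 1 by lra.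
have -> : e / (K + 1) / 2 * K = e * K / 2 / (K + 1) by field; rewrite gt_eqF.
rewrite ltr_pdivrMr // mulrDr; have : 0 <= e * K by rewrite mulr_ge0 // ltW.
by lra.
Qed.

(** The second difference is [t ^+ 2] times the Hessian form in either order, at two points within
    [t * (|u| + |v|)] of [x]. By the Lipschitz bound a positive asymmetry [e] at [x] is at most
    [t * K], which fails for small [t]. *)
Let hess_sym_le x u v : dot u (hess f x *m v) <= dot v (hess f x *m u).
Proof.
rewrite -subr_le0 leNgt; apply/negP; set e := _ - _ => e0.
pose K := 2 * LH * (enorm u + enorm v) * enorm u * enorm v.
have K0 : 0 <= K by rewrite !mulr_ge0 ?addr_ge0 ?enorm_ge0 // ltW.
pose t := e / (K + 1) / 2.
have K1 : 0 < K + 1 by rewrite ltr_wpDl.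
have t0 : 0 < t by rewrite !divr_gt0.
have [y yx Ey] := second_difference_mvt x u v t0.
have [z zx Ez] := second_difference_mvt x v u t0.
have Eyz : dot u (hess f y *m v) = dot v (hess f z *m u).
  apply: (@mulfI _ (t ^+ 2)); first by rewrite expf_neq0 // gt_eqF.
  by rewrite -Ey -Ez (addrAC x (t *: v)); ring.
have h1 := dot_hess_lip x y u v; have h2 := dot_hess_lip z x v u.
have : e <= t * K.
  apply: (le_trans (split_diff Eyz h1 h2)).
  have -> : t * K = LH * (t * (enorm u + enorm v)) * enorm u * enorm v +
     LH * (t * (enorm v + enorm u)) * enorm v * enorm u.
    by rewrite /K; ring.
  by apply: lerD; rewrite !ler_wpM2r ?enorm_ge0 // ler_wpM2l ?(ltW LH_gt0) //
    -enormN opprB.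
by rewrite leNgt => /negP; apply; exact: half_frac_lt.
Qed.

Lemma dot_hess_sym x u v : dot u (hess f x *m v) = dot v (hess f x *m u).
Proof. by apply/eqP; rewrite eq_le !hess_sym_le. Qed.

Lemma hess_sym x : (hess f x)^T = hess f x.
Proof.
have entry i j : hess f x i j = dot (delta_mx i 0) (hess f x *m delta_mx j 0).
  rewrite dotC dotE -colE (bigD1 i) //= !mxE !eqxx mulr1 big1 ?addr0 //.
  by move=> k ki; rewrite !mxE (negbTE ki) mulr0.
by apply/matrixP => i j; rewrite mxE [LHS]entry dot_hess_sym -entry.
Qed.

Lemma strongly_convex_grad x y :
  f x + dot (grad f x) (y - x) + mu / 2 * enorm (y - x) ^+ 2 <= f y.
Proof.
have := is_derive_grad x (y - x) 0; rewrite scale0r addr0 => dphi.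
suff : dot (grad f x) (y - x) <= f y - f x - mu / 2 * enorm (y - x) ^+ 2 by lra.
(* Strong convexity contributes [- mu / 2 * t * (1 - t)]; its part in [t ^+ 2] is the remainder
   [e]. *)
apply: (is_derive0_le (e := mu / 2 * enorm (y - x) ^+ 2) dphi) => t /andP[t0 t1].
have := f_sconvex y x (t := t); rewrite (ltW t0) t1 => /(_ isT).
have -> : t *: y + (1 - t) *: x = x + t *: (y - x).
  by apply/colP => i; rewrite !mxE; ring.
by rewrite scale0r addr0; lra.
Qed.

Lemma grad_strongly_monotone x y :
  mu * enorm (y - x) ^+ 2 <= dot (grad f y - grad f x) (y - x).
Proof.
have h1 := strongly_convex_grad x y; have h2 := strongly_convex_grad y x.
move: h2; rewrite -(opprB y x) enormN dotNr dotBl; lra.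
Qed.

Lemma hess_ge x w : mu * enorm w ^+ 2 <= sqnormM (hess f x) w.
Proof.
rewrite sqnormME.
have := is_derive_hess x w w 0; rewrite scale0r addr0 => dphi.
apply: (is_derive0_ge dphi) => t /andP[t0 t1].
rewrite scale0r addr0 -dotBr.
have := grad_strongly_monotone x (x + t *: w).
rewrite addrC addKr enormZ gtr0_norm // dotZr dotC.
by rewrite -(ler_pM2l t0) => h; apply: le_trans h; lra.
Qed.

Lemma hess_le x w : sqnormM (hess f x) w <= L * enorm w ^+ 2.
Proof.
rewrite sqnormME.
have := is_derive_hess x w w 0; rewrite scale0r addr0 => dphi.
apply: (is_derive0_le (e := 0) dphi) => t /andP[t0 t1].
rewrite scale0r addr0 -dotBr (le_trans (dot_le_enorm _ _)) // mulr0 addr0.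
rewrite mulrC expr2 !mulrA ler_wpM2r ?enorm_ge0 //.
have := f_lip1 (x + t *: w) x; rewrite [_ - x]addrC addKr enormZ gtr0_norm //.
by rewrite mulrA (mulrC L).
Qed.

Let hess_line_continuous x u i j :
  continuous (fun t : R => hess f (x + t *: u) i j).
Proof.
apply: (@lipschitz_continuous _ _ (LH * enorm u)) => s t.
apply: (le_trans (entryB_le_opnorm _ _ _ _)); apply: (le_trans (f_lip2 _ _)).
have -> : x + s *: u - (x + t *: u) = (s - t) *: u.
  by rewrite opprD addrACA subrr add0r -scalerBl.
by rewrite enormZ -mulrA (mulrC (enorm u)).
Qed.

Let dot_hess_line x u v w t : dot w (hess f (x + t *: u) *m v) =
  \sum_i w i 0 * (\sum_j v j 0 * hess f (x + t *: u) i j).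
Proof.
rewrite dotE; apply: eq_bigr => i _; rewrite mxE; congr (_ * _).
by apply: eq_bigr => j _; rewrite mulrC.
Qed.

Lemma dot_hess_line_continuous x u v w :
  continuous (fun t : R => dot w (hess f (x + t *: u) *m v)).
Proof.
under eq_fun do rewrite dot_hess_line.
have h i := Rintegral01_sum (fun j => v j 0) (@hess_line_continuous x u i).
exact: (Rintegral01_sum (fun i => w i 0) (fun i => (h i).1)).1.
Qed.

(** The mean Hessian is integrated entry by entry; with the bilinear form inside the integral,
    pointwise Hessian bounds pass to the mean. *)
Lemma dot_mean_hess x u v w : dot w (mean_hess f x u *m v) =
  \int[lebesgue_measure]_(t in `[0%R, 1%R]) dot w (hess f (x + t *: u) *m v).
Proof.
under eq_Rintegral do rewrite dot_hess_line.
have h i := Rintegral01_sum (fun j => v j 0) (@hess_line_continuous x u i).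
rewrite (Rintegral01_sum (fun i => w i 0) (fun i => (h i).1)).2 dotE.
apply: eq_bigr => i _; rewrite (h i).2 mxE; congr (_ * _).
by apply: eq_bigr => j _; rewrite mxE mulrC.
Qed.

Lemma mean_hess_sym x u : (mean_hess f x u)^T = mean_hess f x u.
Proof.
apply/matrixP => i j; rewrite !mxE; apply: eq_Rintegral => t _.
by rewrite -[in LHS]hess_sym mxE.
Qed.

Lemma mean_hess_secant x u : mean_hess f x u *m u = grad f (x + u) - grad f x.
Proof.
apply/colP => i.
have coord (z : 'cV[R]_n) : z i 0 = dot (delta_mx i 0) z.
  rewrite dotE (bigD1 i) //= !mxE !eqxx mul1r big1 ?addr0 //.
  by move=> k ki; rewrite !mxE (negbTE ki) mul0r.
rewrite !coord dot_mean_hess dotBr.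
rewrite (Rintegral01_derive (@dot_hess_line_continuous x u u (delta_mx i 0))
  (is_derive_hess x u (delta_mx i 0))).
by rewrite scale1r scale0r addr0.
Qed.

Let sqnorm_hess_integrable x u w : lebesgue_measure.-integrable `[0%R, 1%R]
  (EFin \o (fun t : R => dot w (hess f (x + t *: u) *m w))).
Proof. exact/continuous_integrable01/dot_hess_line_continuous. Qed.

Let cst_integrable (c : R) :
  lebesgue_measure.-integrable `[0%R, 1%R] (EFin \o (fun _ : R => c)).
Proof. exact/continuous_integrable01/cst_continuous. Qed.

Lemma mean_hess_ge x u w : mu * enorm w ^+ 2 <= sqnormM (mean_hess f x u) w.
Proof.
rewrite sqnormME dot_mean_hess -{1}[mu * _]Rintegral01_cst le_Rintegral //.
by move=> t _; rewrite -sqnormME hess_ge.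
Qed.

Lemma mean_hess_le x u w : sqnormM (mean_hess f x u) w <= L * enorm w ^+ 2.
Proof.
rewrite sqnormME dot_mean_hess -[L * _]Rintegral01_cst le_Rintegral //.
by move=> t _; rewrite -sqnormME hess_le.
Qed.

Let sqnorm_mean_hess x u w : sqnormM (mean_hess f x u) w =
  \int[lebesgue_measure]_(t in `[0%R, 1%R]) dot w (hess f (x + t *: u) *m w).
Proof. by rewrite sqnormME dot_mean_hess. Qed.

Let le_add_diff (a b c p q : R) : a = p -> b = q -> p - q <= c -> a <= b + c.
Proof. lra. Qed.

(** The two means run over consecutive segments, from [x] to [y] and from [y] to [y + v]. At equal
    parameter [t] the points differ by [(1 - t) *: (y - x) + t *: v]. *)
Lemma mean_hess_drift x y v w :
  sqnormM (mean_hess f y v) w <= sqnormM (mean_hess f x (y - x)) w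
    + LH * (enorm (y - x) + enorm v) * enorm w ^+ 2.
Proof.
have [u uE] : exists u, u = y - x by exists (y - x).
rewrite -uE; apply: (le_add_diff (sqnorm_mean_hess y v w)
  (sqnorm_mean_hess x u w)).
rewrite -(RintegralB _ (sqnorm_hess_integrable y v w)
  (sqnorm_hess_integrable x u w)); last exact: measurable_itv.
rewrite -[leRHS]Rintegral01_cst.
apply: le_Rintegral => //.
  apply: continuous_integrable01 => t.
  by apply: cvgB; exact: dot_hess_line_continuous.
move=> t /=; rewrite in_itv /= => /andP[t0 t1].
apply: (le_trans (dot_hess_lip _ _ _ _)).
rewrite expr2 mulrA !ler_wpM2r ?enorm_ge0 // ler_wpM2l ?(ltW LH_gt0) //.
have -> : y + t *: v - (x + t *: u) = (1 - t) *: u + t *: v.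
  by rewrite uE; apply/colP => i; rewrite !mxE; ring.
apply: (le_trans (enormD _ _)); rewrite !enormZ !ger0_norm ?subr_ge0 //.
have := enorm_ge0 u; have := enorm_ge0 v; nra.
Qed.

End TwiceDifferentiable.

(** * The rate as a statement about real sequences *)

Section Rate.
Variable R : realType.

Lemma sqr_sum_le N (y : 'I_N -> R) : (\sum_i y i) ^+ 2 <= N%:R * \sum_i y i ^+ 2.
Proof.
have psd1 (w : 'cV[R]_N) : 0 <= sqnormM 1%:M w.
  by rewrite sqnormME mul1mx dot_ge0.
have := @psd_cauchy_schwarz R N 1%:M (const_mx 1) (\col_i y i) (trmx1 _ _) psd1.
rewrite !mul1mx !dotE.
under eq_bigr do rewrite !mxE mul1r.
under [X in _ <= X * _]eq_bigr do rewrite !mxE mul1r.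
under [X in _ <= _ * X]eq_bigr do rewrite !mxE -expr2.
by rewrite sumr_const card_ord.
Qed.

Lemma powR_root4 (N : nat) : ((N%:R : R) `^ 4^-1) ^+ 4 = N%:R.
Proof.
rewrite -powR_mulrn ?powR_ge0 // -powRrM mulVf ?pnatr_eq0 //.
by rewrite powRr1.
Qed.

(** Here [a] is the fourth root of [N]. Cauchy-Schwarz bounds the sum of [r k]; applied again to the
    square roots it produces [a ^+ 3], the origin of the exponent [3/4]. *)
Lemma sum_sqrt_le N (r : 'I_N -> R) (C0 a : R) : 0 <= a -> a ^+ 4 = N%:R ->
  0 <= C0 -> (forall k, 0 <= r k) -> \sum_k r k ^+ 2 <= C0 ^+ 2 ->
  \sum_k r k <= a ^+ 2 * C0 /\
  \sum_k Num.sqrt (r k) <= a ^+ 3 * Num.sqrt C0.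
Proof.
move=> a0 aN C00 r0 rC.
have s1 : \sum_k r k <= a ^+ 2 * C0.
  rewrite -(@ler_pXn2r _ 2) ?nnegrE ?mulr_ge0 ?exprn_ge0 ?sumr_ge0 //.
  rewrite (le_trans (sqr_sum_le _)) // exprMn -exprM aN.
  by rewrite ler_wpM2l.
split=> //.
rewrite -(@ler_pXn2r _ 2) ?nnegrE ?mulr_ge0 ?exprn_ge0 ?sqrtr_ge0 //;
  last by rewrite sumr_ge0 // => k _; rewrite sqrtr_ge0.
rewrite (le_trans (sqr_sum_le _)) // exprMn (sqr_sqrtr C00) -aN.
under eq_bigr do rewrite sqr_sqrtr //.
have -> : (a ^+ 3) ^+ 2 * C0 = a ^+ 4 * (a ^+ 2 * C0) by ring.
by rewrite ler_wpM2l // exprn_ge0.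
Qed.

Lemma amgm_rate N (e d : nat -> R) : (forall k, (k < N)%N -> 0 <= d k) ->
  (forall k, 0 <= e k) ->
  (forall k, (k < N)%N -> e k.+1 ^+ 2 <= d k * e k ^+ 2) ->
  e N ^+ 2 <= ((\sum_(k < N) d k) / N%:R) ^+ N * e 0%N ^+ 2.
Proof.
move=> d0 e0 ed.
have prodE m : (m <= N)%N -> e m ^+ 2 <= (\prod_(k < m) d k) * e 0%N ^+ 2.
  elim: m => [_|m IH mN]; first by rewrite big_ord0 mul1r.
  rewrite big_ord_recr /= (le_trans (ed _ mN)) //.
  by rewrite mulrAC [leRHS]mulrC ler_wpM2l ?d0 // IH // ltnW.
apply: (le_trans (prodE _ (leqnn _))); rewrite ler_wpM2r ?sqr_ge0 //.
have := @leif_AGM R 'I_N predT (fun k => d k) (fun k _ => d0 k (ltn_ord k)).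
by rewrite cardT size_enum_ord => -[].
Qed.

(** In the application [e] is the norm of [F'], [r] the step length, [T] the trace of [Gt], [d] the
    trace removed by an SR1 step, [K] is [n * kbar] and [K0] is [n * L]. *)
Variables (N : nat) (e d r T lam : nat -> R) (mu LH L K K0 C0 : R).
Hypotheses (mu_gt0 : 0 < mu) (LH_gt0 : 0 < LH) (L_gt0 : 0 < L).
Hypotheses (K_ge0 : 0 <= K) (K0_ge0 : 0 <= K0) (C0_ge0 : 0 <= C0).
Hypotheses (e_ge0 : forall k, 0 <= e k) (r_ge0 : forall k, 0 <= r k).
Hypothesis d_ge0 : forall k, (k < N)%N -> 0 <= d k.
Hypothesis e_step : forall k, (k < N)%N -> e k.+1 ^+ 2 <= d k / mu * e k ^+ 2.
Hypothesis T_step : forall k, (k < N)%N -> d k + T k.+1 <= T k + lam k.+1 * K.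
Hypotheses (T_0 : T 0%N = K0) (T_N : 0 <= T N).
Hypothesis lamE : forall k, (k < N)%N ->
  lam k.+1 = mu^-1 * (Num.sqrt (LH * e k.+1) + LH * r k).
Hypothesis e_le_r : forall k, (k < N)%N -> e k.+1 <= (L + K) * r k.
Hypothesis r_sum : \sum_(k < N) r k ^+ 2 <= C0 ^+ 2.

Let Theta := mu^-1 * (LH * C0 + Num.sqrt (LH * (L + K) * C0)).
Let a := (N%:R : R) `^ 4^-1.

(** The bound [e_le_r] reduces this to the sums of [r k] and of its square root. The former grows
    only like [a ^+ 2], but [a >= 1] for [N > 0], so both fit under [a ^+ 3]. *)
Let sum_lam : (0 < N)%N -> \sum_(k < N) lam k.+1 <= Theta * a ^+ 3.
Proof.
move=> N0; have a0 : 0 <= a := powR_ge0 _ _.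
have aN : a ^+ 4 = N%:R := powR_root4 N.
have a1 : 1 <= a.
  by rewrite -(@ler_pXn2r _ 4) ?nnegrE // expr1n aN ler1n.
have [s1 s2] := sum_sqrt_le a0 aN C0_ge0 (fun k : 'I_N => r_ge0 k) r_sum.
have LK : 0 <= LH * (L + K).
  by rewrite mulr_ge0 ?addr_ge0 ?(ltW LH_gt0) ?(ltW L_gt0).
apply: (@le_trans _ _ (\sum_(k < N) mu^-1 *
    (Num.sqrt (LH * (L + K)) * Num.sqrt (r k) + LH * r k))).
  apply: ler_sum => k _; rewrite lamE // ler_wpM2l ?invr_ge0 ?(ltW mu_gt0) //.
  by rewrite lerD2r -sqrtrM // ler_wsqrtr // -mulrA ler_pM2l // e_le_r.
rewrite -mulr_sumr big_split /= -!mulr_sumr /Theta -mulrA.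
rewrite ler_wpM2l ?invr_ge0 ?(ltW mu_gt0) // mulrDl addrC lerD //.
  rewrite -mulrA ler_wpM2l ?(ltW LH_gt0) // (le_trans s1) // mulrC.
  by rewrite ler_wpM2l // ler_weXn2l.
by rewrite (sqrtrM C0 LK) -mulrA ler_wpM2l ?sqrtr_ge0 // mulrC.
Qed.

(** Summing [T_step] telescopes the traces; the last one is nonnegative and the first is absorbed by
    [K0 <= K0 * a ^+ 3]. *)
Let sum_d : (0 < N)%N -> \sum_(k < N) d k / mu <= (K * Theta + K0) / mu * a ^+ 3.
Proof.
move=> N0; have a0 : 0 <= a := powR_ge0 _ _.
have a1 : 1 <= a.
  by rewrite -(@ler_pXn2r _ 4) ?nnegrE // expr1n powR_root4 ler1n.
have tele m : (m <= N)%N ->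
    \sum_(k < m) d k + T m <= K0 + K * \sum_(k < m) lam k.+1.
  elim: m => [_|m IH mN]; first by rewrite !big_ord0 T_0; lra.
  rewrite !big_ord_recr /= mulrDr.
  by have := IH (ltnW mN); have := T_step mN; lra.
have h1 := tele _ (leqnn N); have h2 := sum_lam N0.
have h3 : K * \sum_(k < N) lam k.+1 <= K * (Theta * a ^+ 3).
  by rewrite ler_wpM2l.
have h4 : K0 <= K0 * a ^+ 3 by rewrite ler_peMr // exprn_ege1.
rewrite -mulr_suml mulrAC ler_wpM2r ?invr_ge0 ?(ltW mu_gt0) // mulrDl addrC.
rewrite -[K * Theta * _]mulrA; apply: (le_trans _ (lerD h4 h3)).
by rewrite (le_trans _ h1) // lerDl.
Qed.

Lemma superlinear_rate :
  e N <= ((K * Theta + K0) / mu / a) `^ (N%:R / 2) * e 0%N.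
Proof.
(* For [N = 0] the base divides by zero, but the exponent is zero as well and the power equals
   [1]. *)
have [N0|N0] := posnP N; first by rewrite N0 mul0r powRr0 mul1r.
have a0 : 0 < a by rewrite powR_gt0 // ltr0n.
have aN : a ^+ 4 = N%:R := powR_root4 N.
have Th0 : 0 <= Theta.
  rewrite mulr_ge0 ?invr_ge0 ?addr_ge0 ?sqrtr_ge0 ?(ltW mu_gt0) //.
  by rewrite mulr_ge0 ?(ltW LH_gt0).
set B := _ / a.
have B0 : 0 <= B.
  by apply/divr_ge0/ltW/a0/divr_ge0/ltW/mu_gt0/addr_ge0/K0_ge0/mulr_ge0.
have dmu0 k : (k < N)%N -> 0 <= d k / mu.
  by move=> kN; rewrite divr_ge0 ?d_ge0 // ltW.
rewrite -(@ler_pXn2r _ 2) ?nnegrE ?mulr_ge0 ?powR_ge0 // exprMn.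
rewrite -(@powR_mulrn _ (B `^ _)) ?powR_ge0 // -powRrM divfK ?pnatr_eq0 //.
rewrite powR_mulrn //.
apply: (le_trans (amgm_rate dmu0 e_ge0 e_step)).
rewrite ler_wpM2r ?sqr_ge0 // ler_pXn2r ?nnegrE //; last first.
  by rewrite divr_ge0 // sumr_ge0 // => k _; rewrite dmu0.
(* As [N = a ^+ 4], the factor [a ^+ 3] of the sum becomes [1 / a] in the average. *)
rewrite ler_pdivrMr ?ltr0n // (le_trans (sum_d N0)) // -aN /B.
by rewrite (exprS a 3) [leRHS]mulrA divfK // gt_eqF.
Qed.

End Rate.

(** * Proximal steps *)

(** The linear term dominates for small [t]. This extracts first-order optimality from comparisons
    along a segment. *)
Lemma linear_coef_ge0 (R : realType) (c e : R) :
  (forall t, 0 < t <= 1 -> 0 <= t * c + t ^+ 2 * e) -> 0 <= c.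
Proof.
move=> quad; rewrite leNgt; apply/negP => c0.
have e1 : 0 < `|e| + 1 by rewrite ltr_wpDl.
pose t := Num.min 1 (- c / (`|e| + 1) / 2).
have t0 : 0 < t by rewrite lt_min ltr01 !divr_gt0 // oppr_gt0.
have t1 : t <= 1 by rewrite ge_min lexx.
have te : t * (`|e| + 1) <= - c / 2.
  by rewrite -ler_pdivlMr // mulrAC ge_min lexx orbT.
have := quad t; rewrite t0 t1 => /(_ isT).
have te' : t * e <= t * (`|e| + 1).
  by rewrite ler_pM2l // (le_trans (ler_norm e)) // lerDl.
rewrite expr2 -mulrA -mulrDr pmulr_rge0 // => h.
by move: te te' h; lra.
Qed.

Section Prox.
Variables (R : realType) (n : nat) (g : 'cV[R]_n -> \bar R).
Hypotheses (g_proper : proper_efun g) (g_convex : convex_efun g).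

Lemma is_argmin_fin_num (q : 'cV[R]_n -> R) z :
  is_argmin (fun y => g y + (q y)%:E)%E z -> g z \is a fin_num.
Proof.
have [gNy [y0 gy0]] := g_proper.
move=> /(_ y0); have := gNy z; have := gNy y0; move: gy0.
by case: (g z) => [?||] //; case: (g y0).
Qed.

Lemma subdiff_fin_num z v : subdiff g z v -> g z \is a fin_num.
Proof.
have [gNy [y0 gy0]] := g_proper.
move=> /(_ y0); have := gNy z; have := gNy y0; move: gy0.
by case: (g z) => [?||] //; case: (g y0).
Qed.

Lemma subdiff_fine z v y : g z \is a fin_num -> g y \is a fin_num ->
  subdiff g z v -> fine (g z) + dot v (y - z) <= fine (g y).
Proof.
move=> /fineK gz /fineK gy /(_ y); rewrite -gz -gy -EFinD lee_fin.
by rewrite gz gy.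
Qed.

Lemma subdiff_monotone y z v w : subdiff g y v -> subdiff g z w ->
  0 <= dot (w - v) (z - y).
Proof.
move=> sv sw; have fy := subdiff_fin_num sv; have fz := subdiff_fin_num sw.
have := subdiff_fine fy fz sv; have := subdiff_fine fz fy sw.
rewrite -(opprB z y) dotNr dotBl; lra.
Qed.

(** Moving from the minimiser [z] towards [y] and bounding [g] by convexity gives
    [0 <= t * c + t ^+ 2 * e], where [c] is the gap in the subgradient inequality and [e] the
    quadratic term of the model. *)
Lemma prox_subdiff (f : 'cV[R]_n -> R) (M : 'M[R]_n) xk z : M^T = M ->
  is_argmin (prox_model g f M xk) z ->
  subdiff g z (- grad f xk - M *m (z - xk)).
Proof.
rewrite /prox_model; move: (grad f xk) => b Msym zmin y.
have fz := is_argmin_fin_num zmin.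
have [/fineK gy|] := boolP (g y \is a fin_num); last first.
  rewrite fin_numE negb_and !negbK => /orP[/eqP gy|/eqP ->]; last by rewrite leey.
  by have := g_proper.1 y; rewrite gy.
have gz := fineK fz; rewrite -gy -gz -EFinD lee_fin.
set gy' := fine (g y) in gy *; set gz' := fine (g z) in gz *.
pose c := gy' - gz' + dot (b + M *m (z - xk)) (y - z).
suff : 0 <= c.
  by rewrite /c -opprD dotNl; lra.
pose e := 2^-1 * dot (y - z) (M *m (y - z)).
apply: (@linear_coef_ge0 _ c e) => t /andP[t0 t1].
have := g_convex y z (t := t); rewrite (ltW t0) t1 => /(_ isT).
have := zmin (t *: y + (1 - t) *: z).
rewrite -gy -gz -!EFinM -EFinD.
have := g_proper.1 (t *: y + (1 - t) *: z).
case: (g (t *: y + (1 - t) *: z)) => [p||] // _.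
rewrite -!EFinD !lee_fin => h1 h2; move: h1.
have -> : t *: y + (1 - t) *: z - xk = (z - xk) + t *: (y - z).
  by apply/colP => i; rewrite !mxE; ring.
have -> : sqnormM M (z - xk + t *: (y - z)) = sqnormM M (z - xk) +
    2 * t * dot (M *m (z - xk)) (y - z) + t ^+ 2 * dot (y - z) (M *m (y - z)).
  move: (z - xk) (y - z) => p' q'.
  rewrite !sqnormME mulmxDr -scalemxAr !(dotDl, dotDr, dotZl, dotZr).
  by rewrite (dot_mulmxr p' M q') Msym (dotC q' (M *m p')); ring.
rewrite (dotDr b (z - xk)) dotZr /e /c dotDl => h1.
by nra.
Qed.

End Prox.

(** * The iteration *)

Section Iteration.
Variables (R : realType) (n N : nat) (u : nat -> 'cV[R]_n).
Variables (J G Gt : nat -> 'M[R]_n) (e lam : nat -> R) (mu L LH kbar : R).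
Hypotheses (mu_gt0 : 0 < mu) (L_gt0 : 0 < L) (LH_gt0 : 0 < LH).
Hypothesis kbar_ge : L <= kbar.
Let r k := enorm (u k).

Hypothesis J_sym : forall k, (J k)^T = J k.
Hypothesis Gt_0 : Gt 0%N = L%:M.
Hypothesis G_step : forall k, (k < N)%N -> G k.+1 = SR1 (J k) (Gt k) (u k).
Hypothesis Gt_step : forall k, (k < N)%N -> let Gh := (1 + lam k.+1) *: G k.+1 in
  Gt k.+1 = if \tr Gh <= n%:R * kbar then Gh else L%:M.

Lemma Gt_sym k : (k <= N)%N -> (Gt k)^T = Gt k.
Proof.
elim: k => [_|k IH kN]; first by rewrite Gt_0 tr_scalar_mx.
rewrite Gt_step //=; case: ifP => _; last by rewrite tr_scalar_mx.
by rewrite linearZ /= G_step // SR1_sym // IH // ltnW.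
Qed.

Lemma Gt_tr_le k : (k <= N)%N -> \tr (Gt k) <= n%:R * kbar.
Proof.
have LI : \tr (L%:M : 'M[R]_n) <= n%:R * kbar.
  by rewrite mxtrace_scalar -[L *+ n]mulr_natl ler_wpM2l.
case: k => [_|k kN]; first by rewrite Gt_0.
by rewrite Gt_step //=; case: ifP.
Qed.

Hypothesis e_ge0 : forall k, 0 <= e k.
Hypothesis lamE : forall k, (k < N)%N ->
  lam k.+1 = mu^-1 * (Num.sqrt (LH * e k.+1) + LH * r k).
Hypothesis e_step : forall k, (k < N)%N ->
  e k.+1 = enorm ((Gt k - J k) *m u k).
Hypothesis J_ge : forall k w, mu * enorm w ^+ 2 <= sqnormM (J k) w.
Hypothesis J_le : forall k w, sqnormM (J k) w <= L * enorm w ^+ 2.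
Hypothesis J_drift : forall k w,
  sqnormM (J k.+1) w <= sqnormM (J k) w + LH * (r k + r k.+1) * enorm w ^+ 2.
Hypothesis Gt_u : forall k, (k < N)%N -> sqnormM (Gt k) (u k) <= e k * r k.

Let lam_ge0 k : (k < N)%N -> 0 <= lam k.+1.
Proof.
move=> kN; rewrite lamE // mulr_ge0 ?invr_ge0 ?(ltW mu_gt0) //.
by rewrite addr_ge0 ?sqrtr_ge0 // mulr_ge0 ?(ltW LH_gt0) // enorm_ge0.
Qed.

(* The square root in the regularisation parameter controls the next step,
   which is not known yet when the parameter is chosen. *)
Let next_step_le (a b c l : R) : 0 <= a -> 0 <= b -> 0 <= c ->
  l = mu^-1 * (Num.sqrt (LH * c) + LH * a) ->
  (1 + l) * (mu * b ^+ 2) <= c * b -> LH * (a + b) <= mu * l.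
Proof.
move=> a0 b0 c0 lE.
have mul : mu * l = Num.sqrt (LH * c) + LH * a by rewrite lE mulVKf ?gt_eqF.
have [s [s0 sE]] : exists s, 0 <= s /\ s = Num.sqrt (LH * c).
  by exists (Num.sqrt (LH * c)); rewrite sqrtr_ge0.
have s2 : s ^+ 2 = LH * c by rewrite sE sqr_sqrtr // mulr_ge0 // ltW.
have -> : (1 + l) * (mu * b ^+ 2) = (mu + mu * l) * b ^+ 2 by ring.
rewrite mul -sE => h; rewrite mulrDr addrC lerD2r.
have [b00|bn0] := eqVneq b 0; first by rewrite b00 mulr0.
have bp : 0 < b by rewrite lt_neqAle eq_sym bn0.
have h1 : (mu + (s + LH * a)) * b <= c.
  by rewrite -(ler_pM2r bp) -mulrA -expr2.
have La : 0 <= LH * a by rewrite mulr_ge0 // ltW.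
have mb : 0 < mu * b by rewrite mulr_gt0.
have Lab : 0 <= LH * a * b by rewrite mulr_ge0.
have sb : s * b <= c by move: h1; rewrite !mulrDl; lra.
(* If [s = 0] then [c = 0], which contradicts [h1] because [mu * b > 0]. Otherwise [s * b <= c]
   times [LH] reads [s * (LH * b) <= s ^+ 2], and [s] cancels. *)
have [s00|sn0] := eqVneq s 0.
  have c00 : c = 0.
    apply/eqP; have := s2; rewrite s00 expr0n /= => /esym/eqP.
    by rewrite mulf_eq0 gt_eqF.
  by move: h1; rewrite !mulrDl c00 s00 mul0r; lra.
have sp : 0 < s by rewrite lt_neqAle eq_sym sn0.
by rewrite -(ler_pM2l sp) -expr2 s2 mulrCA ler_pM2l.
Qed.

(** SR1 turns [J_k <= Gt_k] into [J_k <= G_{k+1}]; the factor [1 + lam] then adds at least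
    [lam * mu * I], which pays for the drift from [J_k] to [J_{k+1}]. After a restart [J <= L I]
    suffices. The second part stops before [N] because it involves the step taken from [k]; the
    first is needed at [N] for the sign of the last trace. *)
Lemma Gt_bounds k : (k <= N)%N ->
  (forall w, mu * enorm w ^+ 2 <= sqnormM (Gt k) w) /\
  ((k < N)%N -> forall w, sqnormM (J k) w <= sqnormM (Gt k) w).
Proof.
have LI (j : nat) :
    (forall w : 'cV[R]_n, mu * enorm w ^+ 2 <= sqnormM (L%:M) w) /\
    (forall w : 'cV[R]_n, sqnormM (J j) w <= sqnormM (L%:M) w).
  split=> w; rewrite sqnormM_scalar //.
  exact: (le_trans (J_ge j w) (J_le j w)).
elim: k => [_|k IH kN].
  by rewrite Gt_0; split; [exact: (LI 0%N).1 | move=> _; exact: (LI 0%N).2].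
have [_ /(_ kN) JGt] := IH (ltnW kN).
rewrite Gt_step //=; case: ifP => trG; last first.
  by split; [exact: (LI 0%N).1 | move=> _; exact: (LI k.+1).2].
have l0 := lam_ge0 kN.
have GJ w : sqnormM (J k) w <= sqnormM (G k.+1) w.
  by rewrite G_step // SR1_ge // Gt_sym // ltnW.
have Gh w : (1 + lam k.+1) * sqnormM (J k) w
    <= sqnormM ((1 + lam k.+1) *: G k.+1) w.
  by rewrite sqnormMZ ler_wpM2l // addr_ge0.
have GtE : Gt k.+1 = (1 + lam k.+1) *: G k.+1 by rewrite Gt_step //= trG.
split=> [w|k1N w].
  apply: (le_trans (J_ge k w)); apply: (le_trans _ (Gh w)).
  rewrite ler_peMl ?lerDl //; apply: (le_trans _ (J_ge k w)).
  by rewrite mulr_ge0 ?sqr_ge0 // ltW.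
(* The premise comes from the lower bound [(1 + lam) * mu * I] on [Gt k.+1] and from [Gt_u], so the
   argument does not presuppose [J k.+1 <= Gt k.+1]. *)
have step : LH * (r k + r k.+1) <= mu * lam k.+1.
  apply: (next_step_le (c := e k.+1)) => //; rewrite ?enorm_ge0 ?lamE //.
  apply: (le_trans _ (Gt_u k1N)); rewrite GtE -lamE //.
  apply: (le_trans _ (Gh _)).
  by rewrite ler_wpM2l ?addr_ge0 // J_ge.
apply: (le_trans (J_drift k w)); apply: (le_trans _ (Gh w)).
rewrite mulrDl mul1r lerD2l.
apply: (@le_trans _ _ (mu * lam k.+1 * enorm w ^+ 2)).
  by rewrite ler_wpM2r ?sqr_ge0.
by rewrite mulrAC [leRHS]mulrC ler_wpM2r.
Qed.

Let d k := \tr (Gt k) - \tr (G k.+1).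

Section Step.
Variable k : nat.
Hypothesis kN : (k < N)%N.

Let JGt w : sqnormM (J k) w <= sqnormM (Gt k) w.
Proof. exact: (Gt_bounds (ltnW kN)).2. Qed.

Let Gtk_sym : (Gt k)^T = Gt k. Proof. by rewrite Gt_sym // ltnW. Qed.

Lemma G_psd w : 0 <= sqnormM (G k.+1) w.
Proof.
rewrite G_step //; apply: le_trans (SR1_ge _ _ _ _ _) => //.
by apply: le_trans (J_ge k w); rewrite mulr_ge0 ?sqr_ge0 // ltW.
Qed.

Lemma tr_decrease_ge0 : 0 <= d k.
Proof.
rewrite /d -raddfB psd_tr_ge0 // => w.
by rewrite sqnormMB subr_ge0 G_step // SR1_le.
Qed.

Lemma e_sqr_tr : e k.+1 ^+ 2 = d k * sqnormM (Gt k - J k) (u k).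
Proof. by rewrite e_step // (SR1_tr_decrease _ (J_sym k)) // /d G_step. Qed.

Lemma r_le_e : mu * r k <= e k.
Proof.
have := le_trans ((Gt_bounds (ltnW kN)).1 (u k)) (Gt_u kN).
rewrite -/(r k); have := enorm_ge0 (u k); rewrite -/(r k) le_eqVlt.
move=> /orP[/eqP <- _|rp]; first by rewrite mulr0 e_ge0.
by rewrite expr2 mulrA ler_pM2r.
Qed.

(** After [e_sqr_tr] it remains to chain [u^T P u <= u^T Gt u <= e r <= e^2 / mu]. *)
Lemma e_contract : e k.+1 ^+ 2 <= d k / mu * e k ^+ 2.
Proof.
rewrite e_sqr_tr -mulrA ler_wpM2l ?tr_decrease_ge0 //.
apply: (@le_trans _ _ (sqnormM (Gt k) (u k))).
  rewrite sqnormMB gerBl; apply: le_trans (J_ge _ _).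
  by rewrite mulr_ge0 ?sqr_ge0 // ltW.
apply: (le_trans (Gt_u kN)).
by rewrite expr2 mulrCA ler_wpM2l // mulrC ler_pdivlMr // mulrC r_le_e.
Qed.

(** As [d k] is at most the trace of [Gt k], [e_sqr_tr] gives
    [e k.+1 ^+ 2 <= n * kbar * (e k.+1 * r k)], and one factor cancels. Adding [L] matches the
    constant inside [Theta]. *)
Lemma e_le_r : e k.+1 <= (L + n%:R * kbar) * r k.
Proof.
have nk0 : 0 <= n%:R * kbar by rewrite mulr_ge0 // (le_trans (ltW L_gt0)).
have d_le : d k <= n%:R * kbar.
  apply: (le_trans _ (Gt_tr_le (ltnW kN))); rewrite /d gerBl.
  exact/psd_tr_ge0/G_psd.
have Pu : sqnormM (Gt k - J k) (u k) <= e k.+1 * r k.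
  rewrite sqnormME e_step // mulrC; exact: dot_le_enorm.
have P0 : 0 <= sqnormM (Gt k - J k) (u k) by rewrite sqnormMB subr_ge0.
have : e k.+1 ^+ 2 <= n%:R * kbar * (e k.+1 * r k).
  by rewrite e_sqr_tr ler_pM // tr_decrease_ge0.
have := e_ge0 k.+1; rewrite le_eqVlt => /orP[/eqP <-|ep].
  by rewrite mulr_ge0 ?enorm_ge0 // addr_ge0 // ltW.
rewrite expr2 mulrCA ler_pM2l // => h; apply: (le_trans h).
by rewrite ler_wpM2r ?enorm_ge0 // lerDr ltW.
Qed.

(** A restart has trace [n * L <= n * kbar], below that of the rejected matrix, so both branches are
    bounded by [(1 + lam)] times the trace of [G k.+1]. That trace is at most [n * kbar], which
    bounds the cost of [lam]. *)
Lemma tr_step :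
  d k + \tr (Gt k.+1) <= \tr (Gt k) + lam k.+1 * (n%:R * kbar).
Proof.
have trG0 : 0 <= \tr (G k.+1) by exact/psd_tr_ge0/G_psd.
have trG : \tr (G k.+1) <= n%:R * kbar.
  apply: (le_trans _ (Gt_tr_le (ltnW kN))); rewrite -subr_ge0.
  exact: tr_decrease_ge0.
have Gt_le : \tr (Gt k.+1) <= (1 + lam k.+1) * \tr (G k.+1).
  rewrite Gt_step //= linearZ /=.
  case: ifP => [_|/negbT]; first by rewrite linearZ.
  rewrite -ltNge => /ltW; apply: le_trans.
  by rewrite mxtrace_scalar -[L *+ n]mulr_natl ler_wpM2l.
have lG : lam k.+1 * \tr (G k.+1) <= lam k.+1 * (n%:R * kbar).
  by rewrite ler_wpM2l // lam_ge0.
rewrite /d -addrA lerD2l addrC lerBlDr (le_trans Gt_le) // mulrDl mul1r addrC.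
by rewrite lerD2r.
Qed.

End Step.

Lemma iteration_rate (C0 : R) : 0 <= C0 ->
  \sum_(k < N) r k ^+ 2 <= C0 ^+ 2 ->
  let K := n%:R * kbar in
  let Theta := mu^-1 * (LH * C0 + Num.sqrt (LH * (L + K) * C0)) in
  e N <= ((K * Theta + n%:R * L) / mu / N%:R `^ 4^-1) `^ (N%:R / 2) * e 0%N.
Proof.
move=> C00 rC; cbv zeta.
have K0 : 0 <= n%:R * kbar by rewrite mulr_ge0 // (le_trans (ltW L_gt0)).
have nL0 : 0 <= n%:R * L by rewrite mulr_ge0 // ltW.
have T0 : \tr (Gt 0%N) = n%:R * L.
  by rewrite Gt_0 mxtrace_scalar -[L *+ n]mulr_natl.
have TN : 0 <= \tr (Gt N).
  apply: psd_tr_ge0 => w; apply: le_trans ((Gt_bounds (leqnn N)).1 w).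
  by rewrite mulr_ge0 ?sqr_ge0 // ltW.
exact: (superlinear_rate mu_gt0 LH_gt0 L_gt0 K0 nL0 C00 e_ge0
  (fun k => enorm_ge0 (u k)) tr_decrease_ge0 e_contract tr_step T0 TN lamE
  e_le_r rC).
Qed.

End Iteration.

(** * Descent of the objective and the convergence rate *)

Lemma objective_descent (R : realType) (n : nat) (g : 'cV[R]_n -> \bar R)
    (f : 'cV[R]_n -> R) (mu : R) (y z v : 'cV[R]_n) :
  proper_efun g -> twice_differentiable f -> strongly_convex mu f ->
  g y \is a fin_num -> subdiff g z v -> 0 <= dot (v + grad f z) (y - z) ->
  fine (g z) + f z + mu / 2 * enorm (y - z) ^+ 2 <= fine (g y) + f y.
Proof.
move=> gp fd fsc gy sv; rewrite dotDl.
have := subdiff_fine (subdiff_fin_num gp sv) gy sv.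
have := strongly_convex_grad fd fsc z y.
move: (fine _) (fine _) (dot _ _) (dot _ _) (_ * _ ^+ 2) (f z) (f y).
by move=> ? ? ? ? ? ? ?; lra.
Qed.

Theorem theorem3p4 (R : realType) (n : nat)
    (g : 'cV[R]_n -> \bar R) (f : 'cV[R]_n -> R) (mu L LH kbar : R)
    (g_proper : proper_efun g)
    (g_lsc : lower_semicontinuous g)
    (g_convex : convex_efun g)
    (mu_gt0 : 0 < mu) (L_gt0 : 0 < L) (LH_gt0 : 0 < LH)
    (f_diff2 : twice_differentiable f)
    (f_sconvex : strongly_convex mu f)
    (f_lip1 : lipschitz_grad L f)
    (f_lip2 : lipschitz_hess LH f)
    (F_bounded : exists m : R, forall x, (m%:E <= objective g f x)%E)
    (kbar_ge : L <= kbar)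
    (x0 v0 : 'cV[R]_n) (v0_subdiff : subdiff g x0 v0)
    (N : nat) (x F' : nat -> 'cV[R]_n) (G Gt : nat -> 'M[R]_n)
    (lam : nat -> R)
    (run : GradSR1PQN g f mu L LH kbar N x0 v0 x F' G Gt lam) :
  let infF := ereal_inf (range (objective g f)) in
  let C0 := Num.sqrt (2 * fine (objective g f x0 - infF)%E / mu) in
  let Theta :=
    mu^-1 * (LH * C0 + Num.sqrt (LH * (L + n%:R * kbar) * C0)) in
  let Cgrad := (n%:R * kbar * Theta + n%:R * L) / mu in
  enorm (F' N) <=
    (Cgrad / N%:R `^ (4^-1)) `^ (N%:R / 2) * enorm (F' 0%N).
Proof.
pose u k := x k.+1 - x k.
pose J k := mean_hess f (x k) (u k).
pose e k := enorm (F' k).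
have J_sym k : (J k)^T = J k := mean_hess_sym f_diff2 LH_gt0 f_lip2 _ _.
have Gt_0 : Gt 0%N = L%:M.
  by rewrite (run_Gt0 run) (run_lam0 run) (run_G0 run) addr0 scale1r.
have Gt_s k : (k <= N)%N -> (Gt k)^T = Gt k.
  exact: (Gt_sym J_sym Gt_0 (run_G run) (run_Gt run)).
(* For [k = 0] the subgradient is the given [v0]; the later ones come from the optimality condition
   of the proximal step. *)
have sub k : (k <= N)%N -> subdiff g (x k) (F' k - grad f (x k)).
  case: k => [_|k kN]; first by rewrite (run_F0 run) (run_x0 run) addrK.
  rewrite (run_F run kN) [X in subdiff g _ X](_ : _ =
    - grad f (x k) - Gt k *m (x k.+1 - x k)); last first.
    by rewrite addrAC [X in X - _]addrAC subrr add0r.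
  exact: (prox_subdiff g_proper g_convex (Gt_s _ (ltnW kN)) (run_x run kN)).
have F'E k : (k < N)%N -> F' k.+1 = - ((Gt k - J k) *m u k).
  move=> kN; have sec := mean_hess_secant f_diff2 f_lip2 (x k) (u k).
  have xE : x k + u k = x k.+1 by rewrite addrC subrK.
  rewrite xE in sec; rewrite mulmxBl opprB; apply: (etrans (run_F run kN)).
  exact: (congr1 (fun z => z - Gt k *m u k) (esym sec)).
have e_step k : (k < N)%N -> e k.+1 = enorm ((Gt k - J k) *m u k).
  by move=> kN; rewrite /e F'E // enormN.
(* The subgradients of [g] at consecutive iterates differ by [- F' k - Gt k *m u k], so monotonicity
   bounds [u^T Gt u] by the product of [- F' k] and [u]. *)
have Gt_u k : (k < N)%N -> sqnormM (Gt k) (u k) <= e k * enorm (u k).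
  move=> kN; have := subdiff_monotone g_proper (sub k (ltnW kN)) (sub k.+1 kN).
  rewrite (run_F run kN) -/(u k) [X in dot X _](_ : _ =
    - F' k - Gt k *m u k); last first.
    move: (grad f _) (grad f _) (Gt k *m u k) (F' k) => p q s t.
    by apply/colP => i; rewrite !mxE; ring.
  rewrite dotBl dotNl subr_ge0 sqnormME (dotC (u k)) => h.
  by apply: (le_trans h); rewrite -dotNl -[e k]enormN; exact: dot_le_enorm.
have J_ge k w : mu * enorm w ^+ 2 <= sqnormM (J k) w.
  exact: (mean_hess_ge f_diff2 f_sconvex f_lip2).
have J_le k w : sqnormM (J k) w <= L * enorm w ^+ 2.
  exact: (mean_hess_le f_diff2 f_lip1 f_lip2).
have J_drift k w : sqnormM (J k.+1) w <= sqnormM (J k) w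
    + LH * (enorm (u k) + enorm (u k.+1)) * enorm w ^+ 2.
  exact: (mean_hess_drift LH_gt0 f_lip2).
have e_ge0 k : 0 <= e k := enorm_ge0 _.
have bounds := Gt_bounds mu_gt0 LH_gt0 J_sym Gt_0 (run_G run)
  (run_Gt run) e_ge0 (run_lam run) J_ge J_le J_drift Gt_u.
pose phi k := fine (g (x k)) + f (x k).
have fin k : (k <= N)%N -> g (x k) \is a fin_num.
  by move=> kN; exact: (subdiff_fin_num g_proper (sub k kN)).
have descent k : (k < N)%N -> phi k.+1 + mu / 2 * enorm (u k) ^+ 2 <= phi k.
  move=> kN; rewrite -[enorm (u k)]enormN opprB.
  apply: (objective_descent g_proper f_diff2 f_sconvex (fin k (ltnW kN))
    (sub k.+1 kN)).
  (* Since [F' k.+1 = - P u] and the displacement is [- u], the sign condition reads [0 <= u^T P u],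
     that is, [J k <= Gt k] along [u]. *)
  have -> : x k - x k.+1 = - u k by rewrite opprB.
  rewrite subrK F'E //.
  rewrite dotNl dotNr opprK dotC -sqnormME sqnormMB.
  by rewrite subr_ge0; exact: (bounds k (ltnW kN)).2.
have tele m : (m <= N)%N ->
    phi m + mu / 2 * (\sum_(k < m) enorm (u k) ^+ 2) <= phi 0%N.
  elim: m => [_|m IH mN]; first by rewrite big_ord0 mulr0 addr0.
  rewrite big_ord_recr /= mulrDr addrA addrAC.
  by apply: (le_trans _ (IH (ltnW mN))); rewrite lerD2r descent.
have FE k : (k <= N)%N -> objective g f (x k) = (phi k)%:E.
  by move=> kN; rewrite /objective EFinD fineK ?fin.
cbv zeta; set infF := ereal_inf _; set C0 := Num.sqrt (2 * _ / mu).
(* [F_bounded] excludes [-oo] and the finite value at [x N] excludes [+oo], so [fine] in [C0] acts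
   on a finite gap. *)
have [i iE i_le] : exists2 i : R, infF = i%:E & i <= phi N.
  have infF_le : (infF <= (phi N)%:E)%E.
    by apply: ereal_inf_lbound; exists (x N) => //; rewrite FE.
  have [m m_le] := F_bounded.
  have m_inf : (m%:E <= infF)%E by apply: le_ereal_inf_tmp => _ [y _ <-].
  move: infF_le m_inf; case: infF {C0} => [i||] //; rewrite ?lee_fin => h _.
  by exists i.
have gap : fine (objective g f x0 - infF)%E = phi 0%N - i.
  by rewrite -(run_x0 run) FE // iE -EFinB.
have sumr : \sum_(k < N) enorm (u k) ^+ 2 <= 2 * (phi 0%N - i) / mu.
  rewrite ler_pdivlMr //; have := tele N (leqnn N); move: i_le.
  by move: (phi N) (phi 0%N) (\sum_(_ < _) _) => ? ? ?; lra.
(* The radicand dominates a sum of squares, so the square root does not take its default value for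
   negative arguments. *)
have C0E : C0 ^+ 2 = 2 * (phi 0%N - i) / mu.
  rewrite /C0 gap sqr_sqrtr //; apply: le_trans sumr.
  by rewrite sumr_ge0 // => k _; rewrite sqr_ge0.
rewrite -C0E in sumr.
exact: (iteration_rate mu_gt0 L_gt0 LH_gt0 kbar_ge J_sym Gt_0 (run_G run)
  (run_Gt run) e_ge0 (run_lam run) e_step J_ge J_le J_drift Gt_u
  (sqrtr_ge0 _) sumr).
Qed.
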